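(* Let $n$ and $\ell$ be positive integers satisfying $7\leq \ell\leq \frac{n-1}{2}$. Then $$t(n,3,\ell)\leq n+t+\binom{t}{2}\Big(n-2-\Big\lfloor\frac{n-2}{\ell-3}\Big\rfloor(\ell-3)\Big)+\binom{t+\big\lfloor\frac{n-2}{\ell-3}\big\rfloor-\big\lceil\frac{n-2}{\ell-3}\big\rceil}{2}\Big(\ell+1-n+\Big\lfloor\frac{n-2}{\ell-3}\Big\rfloor(\ell-3)\Big),$$ where on the right-hand side $t$ denotes the integer $t=\big\lceil\frac{n-2}{\ell-3}\big\rceil$.
   Context: All graphs are finite, undirected and simple. Let $G$ be a nontrivial connected graph of order $n$ (i.e. with $n$ vertices). An edge-coloring of $G$ is any assignment of colors to the edges (adjacent edges may receive the same color). A tree $T$ that is a subgraph of $G$ is a rainbow tree if no two edges of $T$ have the same color. For $S\subseteq V(G)$ with $|S|\geq 2$, a rainbow $S$-tree is a rainbow tree $T$ in $G$ with $S\subseteq V(T)$. For an integer $k$ with $2\leq k\leq n$, an edge-coloring of $G$ is a $k$-rainbow coloring if for every $k$-subset $S$ of $V(G)$ there exists a rainbow $S$-tree. The $k$-rainbow index $rx_k(G)$ is the minimum number of colors needed in a $k$-rainbow coloring of $G$. For integers $2\leq k\leq n$ and $2\leq\ell\leq n-1$, $t(n,k,\ell)$ denotes the minimum size (number of edges) of a connected graph $G$ of order $n$ with $rx_k(G)\leq \ell$ (when such a graph exists). The function $t(\cdot,\cdot,\cdot)$ is not to be confused with the integer $t$ in the claim. *)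

(* Defs.v *)
From mathcomp Require Import all_boot all_order all_algebra.

Set Implicit Arguments.
Unset Strict Implicit.
Unset Printing Implicit Defensive.

Definition is_least (P : nat -> Prop) (m : nat) : Prop :=
  P m /\ forall m' : nat, P m' -> m <= m'.

Record graph (V : finType) := Graph {
  adj : rel V;
  adj_sym : symmetric adj;
  adj_irr : irreflexive adj
}.

Definition edges (V : finType) (G : graph V) : {set {set V}} :=
  [set [set p.1; p.2] | p in [pred p : V * V | adj G p.1 p.2]].

Definition connected_graph (V : finType) (G : graph V) : Prop :=
  forall x y : V, connect (adj G) x y.

Definition is_subgraph (V : finType) (G : graph V)
    (W : {set V}) (F : {set {set V}}) : Prop :=
  F \subset edges G /\ forall e, e \in F -> e \subset W.

Definition edge_rel (V : finType) (F : {set {set V}}) : rel V :=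
  fun x y => [set x; y] \in F.

(* A duplicate-free closed walk [:: x; y] traverses one edge back and forth;
   the genuine cycles are those with at least three vertices. *)
Definition is_tree (V : finType) (W : {set V})
    (F : {set {set V}}) : Prop :=
  [/\ W != set0,
      {in W &, forall x y, connect (edge_rel F) x y} &
      forall p : seq V, ucycle (edge_rel F) p -> size p <= 2].

(* A colouring is given on all vertex sets; only its values on edges of the
   graph matter. *)
Definition rainbow_tree_on (V : finType) (C : Type) (G : graph V)
    (c : {set V} -> C) (S : {set V}) : Prop :=
  exists (W : {set V}) (F : {set {set V}}),
    [/\ is_subgraph G W F, is_tree W F, {in F &, injective c} & S \subset W].

Definition rainbow_coloring (V : finType) (C : Type) (k : nat)
    (G : graph V) (c : {set V} -> C) : Prop :=
  forall S : {set V}, #|S| = k -> rainbow_tree_on G c S.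

(* r = rx_k(G) *)
Definition is_rainbow_index (V : finType) (k : nat) (G : graph V)
    (r : nat) : Prop :=
  is_least
    (fun q => exists c : {set V} -> 'I_q, rainbow_coloring k G c) r.

(* m = t(n, k, l); in particular a graph as required exists. *)
Definition is_min_size (n k l m : nat) : Prop :=
  is_least
    (fun s => exists (V : finType) (G : graph V),
       [/\ #|V| = n, connected_graph G,
           (exists2 r, is_rainbow_index k G r & r <= l) &
           #|edges G| = s]) m.

Definition ceil_div (a b : nat) : nat := (a + b.-1) %/ b.

(* Main.v *)
Require Import Defs.
From mathcomp Require Import all_boot all_order all_algebra.
From mathcomp Require Import zify.
From Stdlib Require Import Classical_Prop.

Set Implicit Arguments.
Unset Strict Implicit.
Unset Printing Implicit Defensive.

(** Put b = l - 3 and N = n - 2. Distribute N vertices over internally disjoint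
    u-v paths with b inner vertices each (the last one possibly shorter), add
    the edge uv, and make the vertices at equal distance from u along their
    path a clique. Colour the path edges by position with 0, ..., b, the clique
    edges with b+1 and uv with b+2. Any three vertices lie on a rainbow path,
    and the clique edges number C(q, 2) * b + q * r where N = q * b + r. *)

Lemma is_least_exists (P : nat -> Prop) m :
  P m -> exists2 k, is_least P k & k <= m.
Proof.
elim/ltn_ind: m => m IHm Pm.
case: (classic (exists2 k, P k & k < m)) => [[k Pk lt_km]|noP].
  by have [k' leastk' le_k'k] := IHm k lt_km Pk; exists k' => //; lia.
exists m => //; split=> // k Pk; rewrite leqNgt; apply/negP => lt_km.
by apply: noP; exists k.
Qed.

Lemma set2_eq (T : finType) (x y a b : T) :
  [set x; y] = [set a; b] -> (x = a /\ y = b) \/ (x = b /\ y = a).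
Proof.
move=> eq_xy.
have xin : x \in [set a; b] by rewrite -eq_xy set21.
have yin : y \in [set a; b] by rewrite -eq_xy set22.
have ain : a \in [set x; y] by rewrite eq_xy set21.
have bin : b \in [set x; y] by rewrite eq_xy set22.
by case/set2P: xin; case/set2P: yin; case/set2P: ain; case/set2P: bin;
  intuition congruence.
Qed.

Lemma uniq_map_inj (T1 T2 : eqType) (f : T1 -> T2) (s : seq T1) :
  uniq (map f s) -> {in s &, injective f}.
Proof.
elim: s => //= a s IHs /andP[fa_notin uniq_fs] x y.
rewrite !inE => /orP[/eqP->|xs] /orP[/eqP->|ys] //.
- by move=> eq_f; rewrite eq_f (map_f f ys) in fa_notin.
- by move=> eq_f; rewrite -eq_f (map_f f xs) in fa_notin.
- exact: IHs.
Qed.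

Definition walk_edges (V : finType) (x : V) (s : seq V) : seq {set V} :=
  pairmap (fun y z => [set y; z]) x s.

Lemma walk_edges_index (V : finType) (x y z : V) (s : seq V) :
  uniq (x :: s) -> [set y; z] \in walk_edges x s ->
  [/\ y \in x :: s, z \in x :: s &
      (index z (x :: s) = (index y (x :: s)).+1) \/
      (index y (x :: s) = (index z (x :: s)).+1)].
Proof.
move=> uniq_s /(nthP set0)[i]; rewrite size_pairmap => lt_is.
rewrite (nth_pairmap x) //.
have eq1 : index (nth x (x :: s) i) (x :: s) = i.
  by apply: index_uniq => //=; lia.
have eq2 : index (nth x s i) (x :: s) = i.+1.
  by apply: (@index_uniq _ x i.+1 (x :: s)) => //=; lia.
have in1 : nth x (x :: s) i \in x :: s by apply: mem_nth => /=; lia.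
have in2 : nth x s i \in x :: s.
  by rewrite inE mem_nth ?orbT.
by case/set2_eq => -[<- <-]; split=> //; rewrite eq1 eq2; auto.
Qed.

Lemma walk_edges_path (V : finType) (e : rel V) (x : V) (s : seq V) E :
  path e x s -> E \in walk_edges x s ->
  exists y z, [/\ e y z, E = [set y; z], y \in x :: s & z \in x :: s].
Proof.
elim: s x => //= y s IHs x /andP[exy path_s].
rewrite inE => /orP[/eqP->|Es].
  by exists x, y; rewrite !inE !eqxx orbT.
have [a [c [eac -> ain cin]]] := IHs y path_s Es.
by exists a, c; split=> //; rewrite inE ?ain ?cin orbT.
Qed.

Lemma edge_rel_walk (V : finType) (x : V) (s : seq V) (F : {set {set V}}) :
  {subset walk_edges x s <= F} -> path (edge_rel F) x s.
Proof.
elim: s x => //= y s IHs x sub; apply/andP; split.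
  by apply: sub; rewrite inE eqxx.
by apply: IHs => E Es; apply: sub; rewrite inE; apply/orP; right.
Qed.

Lemma path_is_tree (V : finType) (x : V) (s : seq V) :
  uniq (x :: s) ->
  is_tree [set y in x :: s] [set E in walk_edges x s].
Proof.
move=> uniq_s; set F := [set E in walk_edges x s].
have F_sym : symmetric (edge_rel F) by move=> y z; rewrite /edge_rel setUC.
have path_F : path (edge_rel F) x s.
  by apply: edge_rel_walk => E; rewrite inE.
have conn_x y : y \in x :: s -> connect (edge_rel F) x y.
  exact: path_connect path_F y.
split.
- by apply/set0Pn; exists x; rewrite !inE eqxx.
- move=> y z; rewrite inE => yin; rewrite inE => zin.
  apply: (@connect_trans _ _ x); last exact: conn_x.
  by rewrite (sym_connect_sym F_sym); apply: conn_x.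
- (* Both cycle-neighbours of the vertex of largest index on the path would
     be its predecessor on the path. *)
  move=> p /andP[cyc_p uniq_p]; rewrite leqNgt; apply/negP => size_p.
  have [y0 y0p] : exists y, y \in p.
    by case: p size_p {cyc_p uniq_p} => // y p _; exists y; rewrite inE eqxx.
  case: (@arg_maxnP _ y0 (mem p) (fun y => index y (x :: s)) y0p) => m mp max_m.
  have [i p' def_p] := rot_to mp.
  rewrite -(rot_cycle i) def_p in cyc_p.
  rewrite -(rot_uniq i) def_p in uniq_p.
  have p'p y : y \in p' -> y \in p.
    by move=> yp'; rewrite -(mem_rot i) def_p inE yp' orbT.
  have : size (rot i p) = (size p').+1 by rewrite def_p.
  rewrite size_rot => eq_size.
  case: p' {def_p} p'p eq_size cyc_p uniq_p => [|a p'] p'p /= eq_size; first by lia.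
  rewrite rcons_path => /andP[ma /andP[_ lm]].
  case/andP=> _ /andP[a_notin _].
  rewrite /edge_rel inE in ma; rewrite /edge_rel inE in lm.
  have [_ ain ima] := walk_edges_index uniq_s ma.
  have [lin _ ilm] := walk_edges_index uniq_s lm.
  have maxa : index a (x :: s) <= index m (x :: s) :=
    max_m a (p'p a (mem_head _ _)).
  have maxl : index (last a p') (x :: s) <= index m (x :: s) :=
    max_m (last a p') (p'p _ (mem_last _ _)).
  have eq_al : a = last a p'.
    by apply: (index_inj x ain lin) => /=; move: ima ilm maxa maxl => /=; lia.
  case: p' a_notin eq_al {p'p lm lin ilm maxl} eq_size => [|c p'] /= a_notin eq_al.
    by lia.
  by move: a_notin; rewrite {1}eq_al mem_last.
Qed.

Lemma rainbow_path_tree (V : finType) (C : eqType) (G : graph V)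
    (c : {set V} -> C) (S : {set V}) (x : V) (s : seq V) :
  path (adj G) x s -> uniq (x :: s) -> uniq (map c (walk_edges x s)) ->
  {subset S <= x :: s} -> rainbow_tree_on G c S.
Proof.
move=> path_s uniq_s uniq_c subS.
exists [set y in x :: s], [set E in walk_edges x s]; split.
- split=> [|E].
    apply/subsetP=> E; rewrite inE => Es.
    have [y [z [yz -> _ _]]] := walk_edges_path path_s Es.
    by apply/imsetP; exists (y, z).
  rewrite inE => Es; have [y [z [_ -> yin zin]]] := walk_edges_path path_s Es.
  by apply/subsetP=> v; rewrite !inE => /orP[]/eqP->; rewrite -in_cons.
- exact: path_is_tree.
- by move=> E E'; rewrite !inE; apply: uniq_map_inj.
- by apply/subsetP=> y yS; rewrite inE subS.
Qed.

Definition level (N b m : nat) : nat :=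
  if m < N then (m %% b).+1 else if m == N then 0 else b.+1.

Definition theta_color (N b x y : nat) : nat :=
  if level N b x == level N b y then b.+1
  else if (N <= x) && (N <= y) then b.+2
  else minn (level N b x) (level N b y).

Definition theta_down (N b x y : nat) : bool :=
  (x < y) &&
  (if y < N then (x.+1 == y) && ~~ (b %| y) || (x == y %[mod b])
   else if y == N then b %| x
   else [|| x == N, x.+1 == N | b %| x.+1]).

Definition theta_adj (N b x y : nat) : bool :=
  theta_down N b x y || theta_down N b y x.

Definition rainbow_walk (N b x : nat) (s : seq nat) : bool :=
  [&& path (theta_adj N b) x s, uniq (x :: s)
    & uniq (pairmap (theta_color N b) x s)].

Lemma theta_color_sym N b x y : theta_color N b x y = theta_color N b y x.
Proof. by rewrite /theta_color eq_sym andbC minnC. Qed.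

Lemma theta_color_le N b x y : 0 < b -> theta_color N b x y < b.+3.
Proof.
move=> b_gt0; rewrite /theta_color /level.
have := ltn_pmod x b_gt0; have := ltn_pmod y b_gt0.
by do !case: ifP; lia.
Qed.

Lemma modn_block b p i : i < b -> (p * b + i) %% b = i.
Proof. by move=> lt_ib; rewrite modnMDl modn_small. Qed.

Lemma divn_block b p i : i < b -> (p * b + i) %/ b = p.
Proof. by move=> lt_ib; rewrite divnMDl ?divn_small ?addn0 //; lia. Qed.

Lemma run_walk N b p i k : i + k < b -> p * b + i + k < N ->
  let a := p * b + i in
  [/\ path (theta_adj N b) (a + k) (rev (iota a k)),
      pairmap (theta_color N b) (a + k) (rev (iota a k)) = rev (iota i.+1 k) &
      last (a + k) (rev (iota a k)) = a].
Proof.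
elim: k => [|k IHk] lt_b lt_N a; first by rewrite addn0.
have [||pathk colk lastk] := IHk; [lia | lia |].
rewrite -addn1 !iotaD !rev_cat /= -/a pathk colk lastk.
have mod1 : (a + k) %% b = i + k.
  by rewrite /a -addnA modn_block //; lia.
have mod2 : (a + (k + 1)) %% b = (i + k).+1.
  by rewrite /a -addnA modn_block //; lia.
have ndvd : ~~ (b %| a + (k + 1)) by rewrite /dvdn mod2.
split=> //.
- rewrite andbT /theta_adj /theta_down ndvd; apply/orP; right.
  by rewrite (_ : a + (k + 1) < N) /a; lia.
- congr (_ :: _); rewrite /theta_color /level mod1 mod2.
  have -> : a + (k + 1) < N by rewrite /a; lia.
  have -> : a + k < N by rewrite /a; lia.
  by do !case: ifP; lia.
Qed.
Lemma rainbow_walk_cat N b x s1 y s2 :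
  let col := theta_color N b in
  rainbow_walk N b x s1 -> rainbow_walk N b y s2 ->
  theta_adj N b (last x s1) y ->
  (forall v, v \in x :: s1 -> v \in y :: s2 -> False) ->
  col (last x s1) y \notin pairmap col x s1 ++ pairmap col y s2 ->
  (forall c, c \in pairmap col x s1 -> c \in pairmap col y s2 -> False) ->
  rainbow_walk N b x (s1 ++ y :: s2).
Proof.
move=> col /and3P[path1 uniq1 ucol1] /and3P[path2 uniq2 ucol2] adj_xy disj.
rewrite mem_cat negb_or => /andP[notin1 notin2] cdisj; apply/and3P; split.
- by rewrite cat_path path1 /= adj_xy.
- rewrite -cat_cons cat_uniq uniq1 uniq2 andbT andTb.
  by apply/hasPn=> v v2; apply/negP=> v1; apply: (disj v).
- rewrite pairmap_cat cat_uniq ucol1 /= notin2 ucol2 !andbT.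
  rewrite negb_or notin1; apply/hasPn=> c c2; apply/negP=> c1.
  exact: (cdisj c).
Qed.

Lemma run_rainbow N b p i k : i + k < b -> p * b + i + k < N ->
  rainbow_walk N b (p * b + i + k) (rev (iota (p * b + i) k)).
Proof.
set a := p * b + i => lt_b lt_N; have [path_a col_a _] := run_walk lt_b lt_N.
rewrite /rainbow_walk path_a col_a rev_uniq iota_uniq.
have -> : a + k :: rev (iota a k) = rev (iota a k.+1).
  by rewrite -addn1 iotaD rev_cat.
by rewrite rev_uniq iota_uniq.
Qed.

Lemma down_walk N b p i : i < b -> p * b + i < N ->
  let w := p * b + i in
  let s := rev (iota (p * b) i) ++ [:: N; N.+1] in
  rainbow_walk N b w s /\
  pairmap (theta_color N b) w s = rev (iota 1 i) ++ [:: 0; b.+2].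
Proof.
move=> lt_ib lt_N w s.
have [//||path_a col_a last_a] := @run_walk N b p 0 i; first by rewrite addn0.
have := @run_rainbow N b p 0 i; move: path_a col_a last_a; rewrite !addn0 => _.
move=> col_a last_a /(_ lt_ib lt_N) run_a.
have lev_pb : level N b (p * b) = 1.
  by rewrite /level modnMl; case: ifP; lia.
have levN : level N b N = 0 by rewrite /level ltnn eqxx.
have levN1 : level N b N.+1 = b.+1 by rewrite /level; do !case: ifP; lia.
have col_u : theta_color N b (p * b) N = 0.
  by rewrite /theta_color lev_pb levN /=; case: ifP; lia.
have col_uv : theta_color N b N N.+1 = b.+2.
  by rewrite /theta_color levN levN1 /= leqnn leqnSn.
split; last by rewrite pairmap_cat col_a last_a /= col_u col_uv.
apply: rainbow_walk_cat => //.
- rewrite /rainbow_walk /= !inE /theta_adj /theta_down eqxx.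
  by do !case: ifP; lia.
- rewrite last_a /theta_adj /theta_down ltnn eqxx dvdn_mull // andbT.
  by apply/orP; left; lia.
- move=> v; rewrite inE mem_rev mem_iota !inE; lia.
- rewrite last_a col_a col_u /= col_uv mem_cat mem_rev mem_iota inE; lia.
- move=> c; rewrite col_a /= col_uv mem_rev mem_iota inE; lia.
Qed.

Lemma tail_walk N b p i p' k :
  i <= k -> k < b -> p * b + i < N -> p' * b + k < N ->
  let w := p * b + i in let z := p' * b + k in
  exists s,
    [/\ rainbow_walk N b w s,
        {subset [:: w; z; N; N.+1] <= w :: s} /\
          (forall m, p * b <= m <= w -> m \in w :: s),
        forall v, v \in w :: s -> v < N.+2 /\
          [\/ N <= v, v %/ b = p /\ v %% b <= i | v %/ b = p' /\ k <= v %% b]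
      & forall c, c \in pairmap (theta_color N b) w s ->
          [\/ c <= i, k < c <= b | c = b.+2]].
Proof.
move=> le_ik lt_kb lt_wN lt_zN w z.
have lt_ib : i < b by lia.
have [rain_w col_w] := down_walk lt_ib lt_wN.
have in_w m : m \in w :: (rev (iota (p * b) i) ++ [:: N; N.+1]) =
    [|| p * b <= m <= w, m == N | m == N.+1].
  by rewrite inE mem_cat mem_rev mem_iota !inE /w; lia.
have w_ver v : p * b <= v <= w -> v %/ b = p /\ v %% b <= i.
  move=> v_in; have -> : v = p * b + (v - p * b) by lia.
  by rewrite divn_block ?modn_block; lia.
have w_col c : c \in pairmap (theta_color N b) w
    (rev (iota (p * b) i) ++ [:: N; N.+1]) -> c <= i \/ c = b.+2.
  by rewrite col_w mem_cat mem_rev mem_iota !inE; lia.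
have [eq_zw | neq_zw] := eqVneq z w.
  exists (rev (iota (p * b) i) ++ [:: N; N.+1]); split=> //.
  - split=> m; last by rewrite in_w => ->.
    by rewrite in_w !inE eq_zw /w; lia.
  - move=> v; rewrite in_w => /orP[v_in|v_N]; last by split; [lia | apply: Or31; lia].
    by split; [lia | apply: Or32; apply: w_ver].
  - by move=> c /w_col[] ?; [apply: Or31 | apply: Or33].
have [d [lt_kd lt_zd end_d]] : exists d,
    [/\ k + d < b, z + d < N & (z + d).+1 = N \/ (k + d).+1 = b].
  by exists (minn (b.-1 - k) (N.-1 - z)); split; lia.
have [path_z col_z last_z] := run_walk lt_kd lt_zd.
have rain_z := run_rainbow lt_kd lt_zd.
rewrite -/z in path_z col_z last_z rain_z.
have z_ver v : v \in z + d :: rev (iota z d) = (z <= v <= z + d).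
  by rewrite inE mem_rev mem_iota; lia.
have z_block v : z <= v <= z + d -> v %/ b = p' /\ k <= v %% b.
  move=> v_in; have -> : v = p' * b + (v - p' * b) by lia.
  by rewrite divn_block ?modn_block; lia.
have last_w : last w (rev (iota (p * b) i) ++ [:: N; N.+1]) = N.+1.
  by rewrite last_cat.
have lev_top : level N b (z + d) = (k + d).+1.
  by rewrite /level lt_zd /z -addnA modn_block.
have col_top : theta_color N b N.+1 (z + d) = (k + d).+1.
  rewrite /theta_color lev_top.
  have -> : level N b N.+1 = b.+1 by rewrite /level; do !case: ifP; lia.
  by do !case: ifP; lia.
exists ((rev (iota (p * b) i) ++ [:: N; N.+1]) ++ (z + d) :: rev (iota z d)).
split.
- apply: rainbow_walk_cat => //.
  + rewrite last_w /theta_adj /theta_down; apply/orP; right.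
    have -> : N.+1 < N = false by lia.
    have -> : N.+1 == N = false by lia.
    have -> : z + d < N.+1 by lia.
    case: end_d => [/eqP -> | end_d]; first by rewrite !orbT.
    rewrite (_ : (z + d).+1 = p'.+1 * b) ?dvdn_mull ?orbT //.
    by rewrite /z mulSn; lia.
  + move=> v; rewrite in_w z_ver => /orP[v_w v_z | v_N v_z]; last by lia.
    have [pv iv] := w_ver v v_w; have [pv' kv] := z_block v v_z.
    by case/eqP: neq_zw; rewrite /z /w -pv -pv'; lia.
  + rewrite last_w col_top mem_cat col_z mem_rev mem_iota negb_or.
    apply/andP; split; last by lia.
    by apply/negP=> /w_col; lia.
  + by move=> c /w_col c_w; rewrite col_z mem_rev mem_iota; lia.
- split=> m; rewrite -cat_cons mem_cat in_w z_ver; last by move=> ->.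
  by rewrite !inE /w; lia.
- move=> v; rewrite -cat_cons mem_cat in_w z_ver.
  case/orP=> [/orP[v_in | v_N]|v_z].
  + by split; [lia | apply: Or32; apply: w_ver].
  + by split; [lia | apply: Or31; lia].
  + by split; [lia | apply: Or33; apply: z_block].
- move=> c; rewrite pairmap_cat mem_cat last_w /= col_z col_top inE.
  rewrite mem_rev mem_iota => /orP[/w_col[]|c_z].
  + by move=> ?; apply: Or31.
  + by move=> ?; apply: Or33.
  + by apply: Or32; lia.
Qed.

(* For x, y, z on levels i <= j <= k, the path runs from y down to level i,
   crosses to x, descends to u, jumps to v and descends to z: it uses the
   colours i+1..j, b+1, 0..i, b+2 and k+1.. in turn. *)
Lemma sorted_walk N b p i p2 j p' k :
  i <= j -> j <= k -> k < b ->
  p * b + i < N -> p2 * b + j < N -> p' * b + k < N ->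
  exists x s, [/\ rainbow_walk N b x s, all (gtn N.+2) (x :: s)
    & {subset [:: p * b + i; p2 * b + j; p' * b + k; N; N.+1] <= x :: s}].
Proof.
move=> le_ij le_jk lt_kb lt_xN lt_yN lt_zN.
have le_ik : i <= k by lia.
have [eq_p|neq_p] := eqVneq p2 p.
  have [s [rain_s [sub1 sub2] ver _]] := tail_walk le_jk lt_kb lt_yN lt_zN.
  exists (p2 * b + j), s; split=> // [|m].
    by apply/allP => v /ver[lt_v _]; exact: lt_v.
  rewrite inE => /orP[/eqP->|]; last exact: sub1.
  by apply: sub2; rewrite eq_p; lia.
have [s [rain_s [sub1 _] ver col_s]] := tail_walk le_ik lt_kb lt_xN lt_zN.
have all_s : all (gtn N.+2) (p * b + i :: s) by apply/allP => v /ver[lt_v _]; exact: lt_v.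
have [eq_y|neq_y] := eqVneq (p2 * b + j) (p' * b + k).
  exists (p * b + i), s; split=> // m.
  by rewrite eq_y => m_in; apply: sub1; move: m_in; rewrite !inE; lia.
have lt_b : i + (j - i) < b by lia.
have lt_N : p2 * b + i + (j - i) < N by lia.
have def_y : p2 * b + i + (j - i) = p2 * b + j by lia.
have [_ col_y last_y] := run_walk lt_b lt_N.
have rain_y := run_rainbow lt_b lt_N.
rewrite def_y in col_y last_y rain_y.
have ver_y v : v \in p2 * b + j :: rev (iota (p2 * b + i) (j - i)) ->
    [/\ v < N, v %/ b = p2 & v %% b <= j].
  rewrite inE mem_rev mem_iota => v_in.
  have -> : v = p2 * b + (v - p2 * b) by lia.
  by rewrite divn_block ?modn_block; try split; lia.
have col_cross : theta_color N b (p2 * b + i) (p * b + i) = b.+1.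
  rewrite /theta_color /level !modn_block; try lia.
  by do !case: ifP; lia.
exists (p2 * b + j), (rev (iota (p2 * b + i) (j - i)) ++ (p * b + i) :: s).
split.
- apply: rainbow_walk_cat => //.
  + rewrite last_y /theta_adj /theta_down !modnMDl eqxx !orbT lt_xN.
    have -> : p2 * b + i < N by lia.
    rewrite !andbT -neq_ltn.
    apply: contra_neq neq_p => /(congr1 (divn^~ b)).
    by rewrite !divn_block //; lia.
  + move=> v /ver_y[vN pv vj] /ver[_ []]; first by lia.
      by case=> pv' _; case/eqP: neq_p; rewrite -pv -pv'.
    case=> pv' kv; case/eqP: neq_y; rewrite -pv -pv'.
    by congr (_ + _); lia.
  + rewrite last_y col_cross mem_cat col_y mem_rev mem_iota negb_or.
    apply/andP; split; first by lia.
    by apply/negP => /col_s[]; lia.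
  + by move=> c; rewrite col_y mem_rev mem_iota => c_in /col_s[]; lia.
- rewrite -cat_cons all_cat all_s andbT.
  by apply/allP => v /ver_y[] /=; lia.
- move=> m m_in; rewrite -cat_cons mem_cat; apply/orP.
  have [-> | neq_m] := eqVneq m (p2 * b + j); first by left; rewrite inE eqxx.
  by right; apply: sub1; move: m_in neq_m; rewrite !inE; lia.
Qed.
Lemma rainbow_walk_internal N b x y z :
  0 < b -> x < N -> y < N -> z < N ->
  exists w s, [/\ rainbow_walk N b w s, all (gtn N.+2) (w :: s)
    & {subset [:: x; y; z; N; N.+1] <= w :: s}].
Proof.
move=> b_gt0.
have sorted_case x' y' z' : x' %% b <= y' %% b -> y' %% b <= z' %% b ->
    x' < N -> y' < N -> z' < N ->
    exists w s, [/\ rainbow_walk N b w s, all (gtn N.+2) (w :: s)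
      & {subset [:: x'; y'; z'; N; N.+1] <= w :: s}].
  move=> le_xy le_yz ltx lty ltz.
  have lt_zb := ltn_pmod z' b_gt0.
  rewrite (divn_eq x' b) (divn_eq y' b) (divn_eq z' b).
  by apply: sorted_walk; rewrite -?divn_eq.
have weaken x' y' z' : perm_eq [:: x'; y'; z'] [:: x; y; z] ->
    (exists w s, [/\ rainbow_walk N b w s, all (gtn N.+2) (w :: s)
      & {subset [:: x'; y'; z'; N; N.+1] <= w :: s}]) ->
    exists w s, [/\ rainbow_walk N b w s, all (gtn N.+2) (w :: s)
      & {subset [:: x; y; z; N; N.+1] <= w :: s}].
  move=> /perm_mem eq_xyz [w [s [rain_s all_s sub]]]; exists w, s; split=> // v.
  move: (sub v) (eq_xyz v); rewrite !inE => sub_v eq_v; rewrite -!in_cons.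
  by move=> v_in; apply: sub_v; lia.
move=> ltx lty ltz.
case: (leqP (x %% b) (y %% b)) => xy; case: (leqP (y %% b) (z %% b)) => yz;
  case: (leqP (x %% b) (z %% b)) => xz; try lia.
- by apply: (weaken x y z) => //; apply: sorted_case; lia.
- apply: (weaken x z y); last by apply: sorted_case; lia.
  by rewrite perm_cons (perm_catC [:: z] [:: y]).
- apply: (weaken z x y); last by apply: sorted_case; lia.
  by rewrite (perm_catC [:: z] [:: x; y]).
- apply: (weaken y x z); last by apply: sorted_case; lia.
  by rewrite (perm_cat2r [:: z] [:: y; x] [:: x; y]) (perm_catC [:: y] [:: x]).
- apply: (weaken y z x); last by apply: sorted_case; lia.
  by rewrite (perm_catC [:: y; z] [:: x]).
- apply: (weaken z y x); last by apply: sorted_case; lia.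
  by rewrite -[[:: z; y; x]]/(rev [:: x; y; z]) perm_rev.
Qed.

Lemma rainbow_walk_exists N b x y z :
  0 < b -> 0 < N -> x < N.+2 -> y < N.+2 -> z < N.+2 ->
  exists w s, [/\ rainbow_walk N b w s, all (gtn N.+2) (w :: s)
    & {subset [:: x; y; z] <= w :: s}].
Proof.
move=> b_gt0 N_gt0 ltx lty ltz.
pose int m := if m < N then m else 0.
have int_lt m : int m < N by rewrite /int; case: ifP.
have [w [s [rain_s all_s sub]]] :=
  rainbow_walk_internal b_gt0 (int_lt x) (int_lt y) (int_lt z).
exists w, s; split=> // v v_in; apply: sub.
by move: v_in; rewrite !inE /int; do !case: ifP; lia.
Qed.

Lemma theta_adj_sym N b : symmetric (relpre (@nat_of_ord N.+2) (theta_adj N b)).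
Proof. by move=> x y; rewrite /= /theta_adj orbC. Qed.

Lemma theta_adj_irr N b :
  irreflexive (relpre (@nat_of_ord N.+2) (theta_adj N b)).
Proof. by move=> x; rewrite /= /theta_adj /theta_down ltnn. Qed.

(* Vertices m < N form paths of b consecutive numbers (the last one possibly
   shorter), joined to u = N at their lower ends and to v = N.+1 at their
   upper ends; m lies on level m %% b + 1, and each level is a clique. *)
Definition theta_graph N b : graph 'I_N.+2 :=
  Graph (@theta_adj_sym N b) (@theta_adj_irr N b).

Definition theta_coloring N b (e : {set 'I_N.+2}) : 'I_b.+3 :=
  inord (oapp (fun p : 'I_N.+2 * 'I_N.+2 => theta_color N b p.1 p.2) 0
    [pick p : 'I_N.+2 * 'I_N.+2 | e == [set p.1; p.2]]).

Lemma theta_coloring_set2 N b (x y : 'I_N.+2) : 0 < b ->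
  theta_coloring b [set x; y] = theta_color N b x y :> nat.
Proof.
move=> b_gt0; rewrite /theta_coloring; case: pickP => [[x' y'] /= /eqP eq_xy|].
  rewrite inordK ?theta_color_le //.
  by case/set2_eq: eq_xy => -[-> ->] //; apply: theta_color_sym.
by move/(_ (x, y)); rewrite eqxx.
Qed.

Lemma theta_coloring_walk N b (x : 'I_N.+2) (s : seq 'I_N.+2) : 0 < b ->
  map val (map (@theta_coloring N b) (walk_edges x s)) =
  pairmap (theta_color N b) (val x) (map val s).
Proof.
move=> b_gt0; elim: s x => //= y s IHs x.
by rewrite theta_coloring_set2 // IHs.
Qed.

Lemma theta_rainbow_path N b (x y z : 'I_N.+2) : 0 < b -> 0 < N ->
  exists (w : 'I_N.+2) (s : seq 'I_N.+2),
    [/\ path (adj (theta_graph N b)) w s, uniq (w :: s),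
        uniq (map (@theta_coloring N b) (walk_edges w s))
      & {subset [:: x; y; z] <= w :: s}].
Proof.
move=> b_gt0 N_gt0.
have [w0 [s0 [/and3P[path_s uniq_s ucol_s] all_s sub]]] :=
  rainbow_walk_exists b_gt0 N_gt0 (ltn_ord x) (ltn_ord y) (ltn_ord z).
pose w : 'I_N.+2 := inord w0; pose s : seq 'I_N.+2 := map inord s0.
have def_w : val w = w0 by case/andP: all_s => lt_w _; apply: inordK.
have def_s : map val s = s0.
  rewrite -map_comp -[RHS]map_id; apply/eq_in_map => v v_in /=.
  by apply: inordK; apply: (allP all_s); rewrite inE v_in orbT.
exists w, s; split.
- by move: path_s; rewrite -def_w -def_s path_map.
- by rewrite -(map_inj_uniq val_inj) /= def_w def_s.
- by rewrite -(map_inj_uniq val_inj) theta_coloring_walk // def_w def_s.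
- move=> v v_in; rewrite -(mem_map val_inj) /= def_w def_s.
  by apply: sub; move: (map_f val v_in).
Qed.

Lemma theta_connected N b : 0 < b -> 0 < N -> connected_graph (theta_graph N b).
Proof.
move=> b_gt0 N_gt0 x y.
have [w [s [path_s _ _ sub]]] := theta_rainbow_path x y y b_gt0 N_gt0.
apply: (@connect_trans _ _ w).
  rewrite (sym_connect_sym (@adj_sym _ (theta_graph N b))).
  by apply: path_connect path_s _ _; apply: sub; rewrite !inE eqxx.
by apply: path_connect path_s _ _; apply: sub; rewrite !inE eqxx !orbT.
Qed.

Lemma theta_rainbow N b : 0 < b -> 0 < N ->
  rainbow_coloring 3 (theta_graph N b) (@theta_coloring N b).
Proof.
move=> b_gt0 N_gt0 S; rewrite cardE => size_S.
have mem_S v : v \in S = (v \in enum S) by rewrite mem_enum.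
case: (enum S) size_S mem_S => [|x [|y [|z []]]] //= _ mem_S.
have [w [s [path_s uniq_s ucol_s sub]]] := theta_rainbow_path x y z b_gt0 N_gt0.
by apply: rainbow_path_tree path_s uniq_s ucol_s _ => v; rewrite mem_S; apply: sub.
Qed.

Lemma card_residue_class M b k (A : {set 'I_M}) :
  {in A &, forall x y : 'I_M, x = y %[mod b]} ->
  {in A, forall x : 'I_M, x %/ b < k} -> #|A| <= k.
Proof.
move=> modA divA; rewrite cardE -(size_map (fun x : 'I_M => x %/ b)).
rewrite -[leqRHS](size_iota 0 k); apply: uniq_leq_size.
  rewrite map_inj_in_uniq ?enum_uniq // => x y; rewrite !mem_enum => xA yA eq_xy.
  by apply: val_inj; rewrite /= (divn_eq x b) (divn_eq y b) eq_xy (modA x y).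
move=> q /mapP[x]; rewrite mem_enum => xA ->.
by rewrite mem_iota divA.
Qed.

Lemma sum_divn b q r : 0 < b -> r <= b ->
  \sum_(y < q * b + r) y %/ b = 'C(q, 2) * b + q * r.
Proof.
move=> b_gt0.
have step c s : \sum_(y < c * b) y %/ b = 'C(c, 2) * b -> s <= b ->
    \sum_(y < c * b + s) y %/ b = 'C(c, 2) * b + c * s.
  move=> IHc; elim: s => [|s IHs] le_sb; first by rewrite muln0 !addn0.
  by rewrite addnS big_ord_recr /= IHs ?divn_block ?mulnS; lia.
elim: q r => [|q IHq] r; apply: step.
  by rewrite mul0n big_ord0.
by rewrite mulSn addnC IHq // binS bin1; lia.
Qed.

Lemma card_theta_down N b (y : 'I_N.+2) : 0 < b ->
  #|[set x : 'I_N.+2 | theta_down N b x y]| <=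
    if y < N then (y %/ b).+1
    else if y == N :> nat then ceil_div N b else N %/ b + 2.
Proof.
move=> b_gt0.
have card1 m : #|[set x : 'I_N.+2 | x == m :> nat]| <= 1.
  apply/card_le1_eqP => x x'; rewrite !inE => /eqP xm /eqP x'm.
  by apply: val_inj; rewrite /= xm x'm.
case: ifP => [lt_yN|ge_yN]; last case: ifP => [eq_yN|neq_yN].
- pose A := [set x : 'I_N.+2 | (x < y) && (x == y %[mod b])].
  apply: (@leq_trans #|[set x : 'I_N.+2 | x == y.-1 :> nat] :|: A|).
    apply: subset_leq_card; apply/subsetP => x.
    by rewrite !inE /theta_down lt_yN; lia.
  apply: leq_trans (leq_card_setU _ _) _; rewrite -[leqRHS]add1n leq_add //.
  apply: (@card_residue_class _ b) => [x x'|x]; rewrite !inE.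
    by case/andP=> _ /eqP-> /andP[_ /eqP->].
  case/andP=> lt_xy /eqP eq_mod; rewrite ltnNge; apply/negP => le_div.
  have := leq_mul le_div (leqnn b).
  by move: lt_xy; rewrite {1}(divn_eq x b) {1}(divn_eq y b) eq_mod; lia.
- apply: (@card_residue_class _ b) => [x x'|x];
    rewrite !inE /theta_down ge_yN eq_yN (eqP eq_yN).
    by case/andP=> _ /eqP-> /andP[_ /eqP->].
  case/andP=> lt_xN dvd_x; rewrite /ceil_div.
  rewrite leq_divRL // mulSn (divnK dvd_x); lia.
- pose A := [set x : 'I_N.+2 | (x < N) && (b %| x.+1)].
  have lt_y := ltn_ord y.
  apply: (@leq_trans #|[set x : 'I_N.+2 | x == N :> nat] :|:
      ([set x : 'I_N.+2 | x == N.-1 :> nat] :|: A)|).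
    apply: subset_leq_card; apply/subsetP => x.
    by rewrite !inE /theta_down ge_yN neq_yN; lia.
  apply: leq_trans (leq_card_setU _ _) _.
  rewrite addn2 -[leqRHS]add1n leq_add //.
  apply: leq_trans (leq_card_setU _ _) _; rewrite -[leqRHS]add1n leq_add //.
  apply: (@card_residue_class _ b) => [x x'|x]; rewrite !inE.
    case/andP=> _ dvd_x /andP[_ dvd_x']; apply/eqP.
    by rewrite -(eqn_modDr 1) !addn1 (eqP dvd_x) (eqP dvd_x').
  case/andP=> lt_xN /dvdnP[c def_x]; rewrite leq_divRL //.
  have -> : x %/ b = c.-1.
    case: c def_x => // c; rewrite mulSn => def_x.
    have -> : x = c * b + b.-1 :> nat by lia.
    by rewrite divn_block; lia.
  by case: c def_x => // c /= <-.
Qed.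

Lemma card_theta_edges N b : 0 < b ->
  #|edges (theta_graph N b)| <=
    N + \sum_(y < N) y %/ b + ceil_div N b + (N %/ b + 2).
Proof.
move=> b_gt0.
pose D := [set p : 'I_N.+2 * 'I_N.+2 | theta_down N b p.2 p.1].
apply: (@leq_trans #|[set [set p.1; p.2] | p in D]|).
  apply: subset_leq_card; apply/subsetP => e /imsetP[[x y] /= xy ->].
  move: xy; rewrite inE /= /theta_adj => /orP[] xy; apply/imsetP.
    by exists (y, x); rewrite ?inE // setUC.
  by exists (x, y); rewrite ?inE.
apply: leq_trans (leq_imset_card _ _) _.
pose B y := if y < N then (y %/ b).+1
  else if y == N then ceil_div N b else N %/ b + 2.
apply: (@leq_trans (\sum_(y < N.+2) B y)).
  rewrite -sum1dep_card -(pair_big_dep xpredT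
    (fun y x : 'I_N.+2 => theta_down N b x y) (fun _ _ => 1)) /=.
  by apply: leq_sum => y _; rewrite sum1dep_card; apply: card_theta_down.
rewrite !big_ord_recr /= /B ltnn eqxx ltnNge leqnSn /=.
rewrite (_ : N.+1 == N = false) ?leq_add2r; last by lia.
rewrite (eq_bigr (fun y : 'I_N => 1 + y %/ b)); last by move=> y _; rewrite ltn_ord.
by rewrite big_split /= sum1_card card_ord.
Qed.

Theorem theorem2p11 (n l : nat) (n_gt0 : 0 < n) (l_gt0 : 0 < l)
    (l_ge7 : 7 <= l) (l_le : 2 * l <= n - 1) :
  let q := (n - 2) %/ (l - 3) in
  let t := ceil_div (n - 2) (l - 3) in
  exists2 m : nat, is_min_size n 3 l m &
    (m%:Z <= n%:Z + t%:Z
      + 'C(t, 2)%:Z * (n%:Z - 2 - q%:Z * (l%:Z - 3))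
      + 'C(t + q - ceil_div (n - 2) (l - 3), 2)%:Z
          * (l%:Z + 1 - n%:Z + q%:Z * (l%:Z - 3)))%R.
Proof.
have [N def_n] : exists N, n = N.+2 by exists n.-2; lia.
have [b def_l] : exists b, l = b.+3 by exists (l - 3); lia.
subst n l => q t.
have b_gt0 : 0 < b by lia.
have N_gt0 : 0 < N by lia.
have [r least_r le_r] : exists2 r,
    is_rainbow_index 3 (theta_graph N b) r & r <= b.+3.
  by apply: is_least_exists; exists (@theta_coloring N b); apply: theta_rainbow.
have [|m least_m le_m] := @is_least_exists (fun s => exists (V : finType) (G : graph V),
    [/\ #|V| = N.+2, connected_graph G,
      (exists2 r, is_rainbow_index 3 G r & r <= b.+3) & #|edges G| = s])
    #|edges (theta_graph N b)|.
  exists 'I_N.+2, (theta_graph N b); split=> //; first exact: card_ord.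
    exact: theta_connected.
  by exists r.
exists m => //.
have le_edges := leq_trans le_m (card_theta_edges N b_gt0).
have eN : N.+2 - 2 = N by lia.
have eb : b.+3 - 3 = b by lia.
rewrite addKn /t /q eN eb {t q}.
set q := N %/ b; set t := ceil_div N b.
have lt_r := ltn_pmod N b_gt0; have def_N := divn_eq N b.
rewrite -/q in def_N; set r0 := N %% b in lt_r def_N.
have sum_N : \sum_(y < N) y %/ b = 'C(q, 2) * b + q * r0.
  by rewrite -(sum_divn q b_gt0 (ltnW lt_r)) -def_N.
have q_ge2 : 2 <= q by rewrite leq_divRL //; lia.
have C2_q : 2 * 'C(q, 2) = q * q.-1
    by have := bin_ffact q 2; rewrite ffactnS ffactn1 mulnC.
have Ct : 'C(t, 2) * r0 = ('C(q, 2) + q) * r0.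
  case: (posnP r0) => [->|r0_gt0]; first by rewrite !muln0.
  have -> : t = q.+1.
    rewrite /t /ceil_div {1}def_N.
    have -> : q * b + r0 + b.-1 = q.+1 * b + r0.-1 by rewrite mulSn; lia.
    by rewrite divn_block; lia.
  by rewrite binS bin1.
rewrite sum_N -/t -/q in le_edges.
have slack : q <= 2 * 'C(q, 2) by rewrite C2_q leq_pmulr; lia.
have -> : (N.+2%:Z - 2 - q%:Z * (b.+3%:Z - 3) = r0%:Z)%R by lia.
have -> : (b.+3%:Z + 1 - N.+2%:Z + q%:Z * (b.+3%:Z - 3) = (b + 2)%:Z - r0%:Z)%R
  by lia.
lia.
Qed.
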